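(* Let $s\in(0,\infty)$, $r\in\mathbb N$ with $r>s$, $f\in\Lambda_s$, and assume the regularity $L$ of the Daubechies wavelet system satisfies $L\ge r-1$. Then there exist constants $c\in(0,1)$, $m\in\mathbb N$ and $R\in(1,\infty)$, independent of $f$ and $j$, such that for any $\varepsilon\in(0,\infty)$ and $j\in\mathbb Z_+$, $$T_j(s,f,\varepsilon)\subset\bigcup_{i=j+1}^{j+m}\big[S_{r,i}(s,f,c\varepsilon)\big]_R.$$
   Context: $\Delta_hf(x):=f(x+h/2)-f(x-h/2)$, $\Delta^{k+1}_h:=\Delta^k_h\Delta_h$, $\Delta_rf(x,y):=\sup_{|h|=y}|\Delta_h^rf(x)|$. $\Lambda_s$: bounded continuous $f$ with $\|f\|_{L^\infty}+\sup_{x,\,y\in(0,1]}\Delta_{\lfloor s\rfloor+1}f(x,y)/y^s<\infty$. $S_{r,i}(s,f,\varepsilon):=\{(x,y)\in\mathbb R^n\times(0,\infty):\Delta_rf(x,y)/y^s>\varepsilon,\ y\in(2^{-i-1},2^{-i}]\}$. $\mathcal D_j=\{2^{-j}(k+[0,1)^n):k\in\mathbb Z^n\}$; $\ell(I)$ side length; $T(I):=I\times(\ell(I)/2,\ell(I)]$. Daubechies wavelet system of regularity $L$ ($\varphi,\psi_\ell\in C^L_c$, $\ell=1,\dots,2^n-1$, vanishing moments up to order $L$, orthonormal basis of $L^2$ together with integer translates of $\varphi$); for $I=2^{-j}(k+[0,1)^n)$, $\psi_{(\ell,I)}:=2^{jn/2}\psi_\ell(2^j\cdot-k)$. $W_j(s,f,\varepsilon):=\{I\in\mathcal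 D_j:\max_{1\le\ell<2^n}|\int f\psi_{(\ell,I)}|>\varepsilon|I|^{s/n+1/2}\}$ and $T_j(s,f,\varepsilon):=\bigcup_{I\in W_j(s,f,\varepsilon)}T(I)$. Hyperbolic metric $\rho(\mathbf x,\mathbf y)=\operatorname{arccosh}(1+\frac{|\mathbf x-\mathbf y|^2}{2x_{n+1}y_{n+1}})$ on $\mathbb R^n\times(0,\infty)$; $A_R:=\{\mathbf x:\inf_{\mathbf y\in A}\rho(\mathbf x,\mathbf y)<R\}$. *)

(* Defs.v *)
From HB Require Import structures.
From mathcomp Require Import all_boot all_order all_algebra.
From mathcomp Require Import all_classical all_reals all_analysis.
Set Implicit Arguments. Unset Strict Implicit. Unset Printing Implicit Defensive.
Import Order.TTheory GRing.Theory Num.Theory.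
Import numFieldNormedType.Exports.
Local Open Scope classical_set_scope.
Local Open Scope ring_scope.

Section Wavelets.
Variables (R : realType) (n : nat).

Definition eucl_norm (x : 'rV[R]_n) : R := Num.sqrt (\sum_(i < n) x ord0 i ^+ 2).

Definition intv (k : 'rV[int]_n) : 'rV[R]_n := map_mx (fun z : int => z%:~R) k.

(* ---------- Lebesgue integral over R^n, as iterated 1-d Lebesgue integrals ---------- *)
Definition rcons0 (m : nat) (t : R) (y : 'rV[R]_m) : 'rV[R]_m.+1 :=
  \row_(i < m.+1) match unlift ord0 i with Some j => y ord0 j | None => t end.

Fixpoint iint (m : nat) : ('rV[R]_m -> R) -> R :=
  match m return ('rV[R]_m -> R) -> R with
  | 0 => fun f => f 0
  | m'.+1 => fun f =>
      Rintegral (@lebesgue_measure R) setT (fun t => iint (fun y => f (rcons0 t y)))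
  end.

Fixpoint CL (k : nat) (g : 'rV[R]_n -> R) : Prop :=
  continuous g /\
  match k with
  | 0 => True
  | k'.+1 => forall i : 'I_n,
      (forall x, derivable g x (delta_mx 0 i)) /\
      CL k' (fun x => derive g x (delta_mx 0 i))
  end.

Definition compact_support (g : 'rV[R]_n -> R) : Prop :=
  compact (closure [set x | g x != 0]).

Definition CLc (k : nat) (g : 'rV[R]_n -> R) : Prop := CL k g /\ compact_support g.

Definition wav_index : Type := ('rV[int]_n + ('I_(2 ^ n - 1) * nat * 'rV[int]_n))%type.

(* psi_(l,I) for I = 2^-j (k + [0,1)^n) *)
Definition psiI (psi : 'I_(2 ^ n - 1) -> 'rV[R]_n -> R) (l : 'I_(2 ^ n - 1)) (j : nat)
  (k : 'rV[int]_n) (x : 'rV[R]_n) : R :=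
  (2 : R) `^ ((j * n)%:R / 2) * psi l ((2 : R) ^+ j *: x - intv k).

Definition wbasis (phi : 'rV[R]_n -> R) (psi : 'I_(2 ^ n - 1) -> 'rV[R]_n -> R)
  (a : wav_index) : 'rV[R]_n -> R :=
  match a with
  | inl k => fun x => phi (x - intv k)
  | inr (l, j, k) => psiI psi l j k
  end.

(* Daubechies wavelet system of regularity L on R^n :
   phi, psi_l in C^L_c, psi_l with vanishing moments up to order L, and
   {phi(. - k)}_k together with {psi_(l,I)}_(l, I in D_j, j >= 0) an orthonormal
   basis of L^2(R^n) (orthonormality + Parseval on the dense class C_c). *)
Definition daubechies_system (L : nat) (phi : 'rV[R]_n -> R)
  (psi : 'I_(2 ^ n - 1) -> 'rV[R]_n -> R) : Prop :=
  [/\ CLc L phi,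
      (forall l, CLc L (psi l)),
      (forall l (alpha : 'I_n -> nat), (\sum_(i < n) alpha i <= L)%N ->
         iint (fun x => (\prod_(i < n) x ord0 i ^+ alpha i) * psi l x) = 0),
      (forall a b : wav_index,
         iint (fun x => wbasis phi psi a x * wbasis phi psi b x) = if a == b then 1 else 0) &
      (forall g : 'rV[R]_n -> R, continuous g -> compact_support g ->
         (iint (fun x => g x ^+ 2))%:E =
         \esum_(a in [set: wav_index]) ((iint (fun x => g x * wbasis phi psi a x)) ^+ 2)%:E)].

Fixpoint cdiff (k : nat) (h : 'rV[R]_n) (f : 'rV[R]_n -> R) : 'rV[R]_n -> R :=
  match k with
  | 0 => f
  | k'.+1 => cdiff k' h (fun x => f (x + 2^-1 *: h) - f (x - 2^-1 *: h))
  end.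

Definition DeltaR (r : nat) (f : 'rV[R]_n -> R) (x : 'rV[R]_n) (y : R) : \bar R :=
  ereal_sup [set (`|cdiff r h f x|)%:E | h in [set h | eucl_norm h = y]].

Definition Lambda (s : R) (f : 'rV[R]_n -> R) : Prop :=
  [/\ continuous f,
      (exists M : R, forall x, `|f x| <= M) &
      (exists C : R, forall x y, 0 < y <= 1 ->
         (DeltaR (`|Num.floor s|%N.+1) f x y * ((y `^ s)^-1)%:E <= C%:E)%E)].

Definition Sset (r i : nat) (s : R) (f : 'rV[R]_n -> R) (eps : R) : set ('rV[R]_n * R) :=
  [set p | (DeltaR r f p.1 p.2 * ((p.2 `^ s)^-1)%:E > eps%:E)%E /\
           2 ^- i.+1 < p.2 <= 2 ^- i].

Definition dcube (j : nat) (k : 'rV[int]_n) : set 'rV[R]_n :=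
  [set x | forall i : 'I_n,
     2 ^- j * (k ord0 i)%:~R <= x ord0 i < 2 ^- j * ((k ord0 i)%:~R + 1)].

Definition tent (j : nat) (k : 'rV[int]_n) : set ('rV[R]_n * R) :=
  [set p | dcube j k p.1 /\ 2 ^- j / 2 < p.2 <= 2 ^- j].

(* W_j(s,f,eps) membership, |I| = 2^-(j n) *)
Definition inW (psi : 'I_(2 ^ n - 1) -> 'rV[R]_n -> R) (s : R) (f : 'rV[R]_n -> R)
  (eps : R) (j : nat) (k : 'rV[int]_n) : Prop :=
  \big[Num.max/0]_(l < 2 ^ n - 1) `|iint (fun x => f x * psiI psi l j k x)|
    > eps * ((2 : R) ^- (j * n)) `^ (s / n%:R + 2^-1).

Definition Tset (psi : 'I_(2 ^ n - 1) -> 'rV[R]_n -> R) (s : R) (f : 'rV[R]_n -> R)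
  (eps : R) (j : nat) : set ('rV[R]_n * R) :=
  \bigcup_(k in [set k | inW psi s f eps j k]) tent j k.

Definition arccosh (t : R) : R := ln (t + Num.sqrt (t ^+ 2 - 1)).

Definition hrho (p q : 'rV[R]_n * R) : R :=
  arccosh (1 + (eucl_norm (p.1 - q.1) ^+ 2 + (p.2 - q.2) ^+ 2) / (2 * p.2 * q.2)).

Definition henlarge (A : set ('rV[R]_n * R)) (Rad : R) : set ('rV[R]_n * R) :=
  [set p | 0 < p.2 /\ (ereal_inf [set (hrho p q)%:E | q in A] < Rad%:E)%E].

End Wavelets.

(* Main.v *)
Require Import Defs.
From HB Require Import structures.
From mathcomp Require Import all_boot all_order all_algebra.
From mathcomp Require Import all_classical all_reals all_analysis.
From mathcomp Require Import ring lra.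
Import Order.TTheory GRing.Theory Num.Theory.
Import numFieldNormedType.Exports.
Local Open Scope classical_set_scope.
Local Open Scope ring_scope.
Set Implicit Arguments. Unset Strict Implicit. Unset Printing Implicit Defensive.

(* After rescaling the cube I to the unit cube, f becomes a function g all of
   whose pure differences of order r with steps of length in (1/4, 1/2] are at
   most d near the support of psi, as soon as (x, y) never enters S_{r,j+1}
   near T(I); a single scale suffices, so m = 1. Kemperman's identity writes
   every mixed difference of order r with small steps h_i as a signed sum of
   2^r pure differences whose steps are small perturbations of a fixed vector
   of length 3/8, so the mixed differences are O(d) too. A discrete Whitney
   theorem then gives a polynomial P of degree < r with |g - P| = O(d) on the
   support of psi: the mixed differences of order r - 1 are approximately
   additive in each step, hence approximately multilinear because g is locally
   bounded, and subtracting a combination of Newton polynomials that matches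
   them on a basis lowers r by one. The vanishing moments kill P, and the
   wavelet coefficient is O(d). *)

(** * Coordinates of a row vector and its norm [|x|], which is the sup norm *)

Section RowNorm.
Variables (R : realType) (n : nat).
Implicit Types x h : 'rV[R]_n.

Lemma norm_coord_le x i : `|x ord0 i| <= `|x|.
Proof.
rewrite [leRHS](mx_normrE x).
exact: (le_bigmax _ (fun ij : 'I_1 * 'I_n => `|x ij.1 ij.2|) (ord0, i)).
Qed.

Lemma norm_row_le x (B : R) : 0 <= B -> (forall i, `|x ord0 i| <= B) -> `|x| <= B.
Proof.
move=> B0 xB; rewrite [leLHS](mx_normrE x); apply/bigmax_leP; split => //.
by move=> [i j] _ /=; rewrite ord1.
Qed.

End RowNorm.

(** * Finite differences, and the bound of mixed ones by pure ones *)

Section Differences.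
Variables (R : realType) (n : nat).
Local Notation V := 'rV[R]_n.
Implicit Types (h x : V) (hs : seq V) (f g : V -> R).

Definition fdiff h f : V -> R := fun x => f (x + h) - f x.

Definition mdiff hs f : V -> R := foldr fdiff f hs.

Lemma mdiff_cons h hs f x : mdiff (h :: hs) f x = mdiff hs f (x + h) - mdiff hs f x.
Proof. by []. Qed.

Lemma fdiffC h k f : fdiff h (fdiff k f) = fdiff k (fdiff h f).
Proof. by apply/funext => x; rewrite /fdiff !(addrAC x h k); ring. Qed.

Lemma fdiff_mdiff h hs f : fdiff h (mdiff hs f) = mdiff hs (fdiff h f).
Proof. by elim: hs => //= k hs IH; rewrite fdiffC IH. Qed.

(** Difference operators commute, so the head of [hs] can be located in [ks] and brought to the
    front. *)
Lemma mdiff_perm hs ks f : perm_eq hs ks -> mdiff hs f = mdiff ks f.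
Proof.
elim: hs ks f => [|h hs IH] ks f.
  by rewrite perm_sym => /perm_nilP ->.
move=> /[dup] /perm_mem/(_ h); rewrite inE eqxx /= => /esym hks.
case/splitPr: hks => k1 k2.
rewrite perm_sym perm_catC cat_cons perm_cons perm_catC perm_sym => /IH -> /=.
rewrite fdiff_mdiff /mdiff !foldr_cat /=.
by rewrite -[foldr _ (fdiff h f) k2]/(mdiff k2 (fdiff h f)) -fdiff_mdiff.
Qed.

Lemma mdiff0 hs : mdiff hs (fun=> 0) = fun=> 0.
Proof. by elim: hs => //= h hs ->; apply/funext => x; rewrite /fdiff subrr. Qed.

Lemma mdiffD hs f g : mdiff hs (fun x => f x + g x) = fun x => mdiff hs f x + mdiff hs g x.
Proof.
by elim: hs => //= h hs ->; apply/funext => x; rewrite /fdiff; ring.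
Qed.

Lemma mdiffZ hs (c : R) f : mdiff hs (fun x => c * f x) = fun x => c * mdiff hs f x.
Proof.
by elim: hs => //= h hs ->; apply/funext => x; rewrite /fdiff; ring.
Qed.

Lemma mdiffB hs f g : mdiff hs (fun x => f x - g x) = fun x => mdiff hs f x - mdiff hs g x.
Proof.
by elim: hs => //= h hs ->; apply/funext => x; rewrite /fdiff; ring.
Qed.

Lemma mdiff_sum (I : Type) (s : seq I) (P : pred I) (F : I -> V -> R) hs :
  mdiff hs (fun x => \sum_(i <- s | P i) F i x) =
  fun x => \sum_(i <- s | P i) mdiff hs (F i) x.
Proof.
elim: s => [|i s IH].
  under eq_fun do rewrite big_nil.
  by rewrite mdiff0; apply/funext => x; rewrite big_nil.
under eq_fun do rewrite big_cons.
under [RHS]eq_fun do rewrite big_cons.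
by case: (P i); rewrite ?mdiffD IH.
Qed.

Lemma mdiff_mem0 hs f x : 0 \in hs -> mdiff hs f x = 0.
Proof.
elim: hs x => [//|h hs IH] x; rewrite inE mdiff_cons => /orP[/eqP <-|h0].
  by rewrite addr0 subrr.
by rewrite !IH // subrr.
Qed.

(** The difference acts on a sequence rather than on a function along a line, so that the steps
    inside the terms may themselves vary with [l], as in Kemperman's identity. *)
Fixpoint ndiff (r : nat) (u : nat -> R) : R :=
  if r is r'.+1 then ndiff r' (fun l => u l.+1) - ndiff r' u else u 0%N.

Lemma ndiffB r (u v : nat -> R) : ndiff r (fun l => u l - v l) = ndiff r u - ndiff r v.
Proof. by elim: r u v => //= r IH u v; rewrite !IH; ring. Qed.

Lemma ndiff_eq0 r (u : nat -> R) : (forall l, (l <= r)%N -> u l = 0) -> ndiff r u = 0.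
Proof.
elim: r u => /= [u -> //|r IH u u0].
by rewrite !IH ?subrr // => l lr; apply: u0 => //; exact: leqW.
Qed.

(** The term of index 0 has coefficient (-1)^r in the expansion, which the absolute values hide. *)
Lemma ndiff_first r (u : nat -> R) :
  (forall l, (0 < l <= r)%N -> u l = 0) -> `|ndiff r u| = `|u 0%N|.
Proof.
elim: r u => //= r IH u u0.
rewrite [X in X - _]ndiff_eq0 => [|l lr]; last exact: u0.
rewrite sub0r normrN IH // => l /andP[l0 lr].
by apply: u0; rewrite l0 ltnW.
Qed.

(** The nodes of the centred difference around [x + (r / 2) h] are [x], [x + h], ..., [x + r h]. *)
Lemma cdiff_ndiff r h f x :
  cdiff r h f (x + (r%:R / 2) *: h) = ndiff r (fun l => f (x + l%:R *: h)).
Proof.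
elim: r f x => [|r IH] f x /=; first by rewrite mul0r scale0r addr0.
have -> : x + (r.+1%:R / 2) *: h = (x + 2^-1 *: h) + (r%:R / 2) *: h.
  by rewrite -addrA -scalerDl; congr (_ + _ *: _); rewrite -natr1; field.
rewrite IH -ndiffB; congr ndiff; apply/funext => l; congr (f _ - f _).
  rewrite -!addrA -!scalerDl; congr (_ + _ *: _).
  by rewrite -natr1; field.
by rewrite addrAC addrK.
Qed.

(** A difference with step [a + l b] subtracts from a progression with base point moved by [a] and
    direction moved by [b] the unmoved one. Each pair thus doubles the number of pure differences
    and takes [t] off both radii. *)
Lemma ndiff_mdiff_le (ab : seq (V * V)) f r (d t X U : R) (u0 : V) :
  0 <= t ->
  (forall x u : V, `|x| <= X -> `|u - u0| <= U ->
     `|ndiff r (fun l => f (x + l%:R *: u))| <= d) ->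
  {in ab, forall p : V * V, `|p.1| <= t /\ `|p.2| <= t} ->
  forall x u : V, `|x| <= X - (size ab)%:R * t -> `|u - u0| <= U - (size ab)%:R * t ->
  `|ndiff r (fun l => mdiff [seq p.1 + l%:R *: p.2 | p <- ab] f (x + l%:R *: u))|
    <= 2 ^+ (size ab) * d.
Proof.
move=> t0 Hf; elim: ab => [|[a b] ab IH] /= Hab x u xX uU.
  by rewrite expr0 mul1r; apply: Hf; [move: xX|move: uU]; rewrite mul0r subr0.
have [/= at_ bt] := Hab (a, b) (mem_head _ _).
have {}IH := IH (fun p pab => Hab p (@mem_behead _ ((a, b) :: ab) p pab)).
rewrite (_ : (fun l : nat => _) = fun l : nat =>
    mdiff [seq p.1 + l%:R *: p.2 | p <- ab] f ((x + a) + l%:R *: (u + b))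
  - mdiff [seq p.1 + l%:R *: p.2 | p <- ab] f (x + l%:R *: u)); last first.
  apply/funext => l; rewrite /fdiff; congr (mdiff _ _ _ - _).
  by rewrite scalerDr addrACA.
move: xX uU; rewrite -natr1 mulrDl mul1r => xX uU.
rewrite ndiffB; apply: le_trans (ler_normB _ _) _.
have -> : (2 : R) ^+ (size ab).+1 * d = 2 ^+ size ab * d + 2 ^+ size ab * d.
  by rewrite exprS; ring.
apply: lerD; apply: IH.
- by apply: le_trans (ler_normD _ _) _; lra.
- by rewrite addrAC; apply: le_trans (ler_normD _ _) _; lra.
- lra.
- lra.
Qed.

(* Kemperman's identity: the arithmetic progressions h_i (1 - l / i), l = 0..r,
   all pass through h_i at l = 0, and for each l in 1..r one of them vanishes. *)
Lemma mdiff_le_pure f r (d t X U : R) (u0 : V) :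
  0 <= t -> r%:R * t <= U ->
  (forall x u : V, `|x| <= X -> `|u - u0| <= U ->
     `|ndiff r (fun l => f (x + l%:R *: u))| <= d) ->
  forall hs x, size hs = r -> {in hs, forall h, `|h| <= t} ->
  `|x| <= X - r%:R * t -> `|mdiff hs f x| <= 2 ^+ r * d.
Proof.
move=> t0 rtU Hf hs x szh hst xX.
(* Indices start at 0, so the progression of index [i] vanishes at [l = i + 1]. *)
pose ab := [seq (nth 0 hs i, - (i.+1%:R^-1 : R) *: nth 0 hs i) | i <- iota 0 r].
have szab : size ab = r by rewrite size_map size_iota.
have key : `|ndiff r (fun l => mdiff [seq p.1 + l%:R *: p.2 | p <- ab] f
                        (x + l%:R *: u0))| <= 2 ^+ r * d.
  have := @ndiff_mdiff_le ab f r d t X U u0 t0 Hf; rewrite szab; apply => //; last first.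
    by rewrite subrr normr0 subr_ge0.
  move=> p /mapP[i]; rewrite mem_iota => /andP[_ ir] -> /=.
  have hit : `|nth 0 hs i| <= t by apply: hst; apply: mem_nth; rewrite szh.
  split=> //; rewrite scaleNr normrN normrZ; apply: le_trans hit.
  rewrite ger0_norm ?invr_ge0 ?ler0n // ler_piMl //.
  by rewrite invf_le1 ?ltr0n // ler1n.
rewrite ndiff_first in key; last first.
  move=> l /andP[l0 lr]; apply: mdiff_mem0; rewrite -map_comp.
  apply/mapP; exists l.-1; first by rewrite mem_iota /= add0n prednK.
  rewrite /= prednK // scalerA mulrN mulfV ?pnatr_eq0 -?lt0n //.
  by rewrite scaleN1r subrr.
move: key; rewrite scale0r addr0 -map_comp.
rewrite (_ : map _ _ = hs) //.
rewrite -[RHS](mkseq_nth 0) /mkseq szh; apply: eq_map => i /=.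
by rewrite scale0r addr0.
Qed.

End Differences.

(** * Polynomials of bounded degree, and Newton polynomials as a basis dual to coordinate
    differences *)

Section Polynomials.
Variables (R : realType) (n : nat).
Local Notation V := 'rV[R]_n.
Implicit Types (h x : V) (p q f : V -> R).

(* [polylt d p]: p is a polynomial function of total degree < d. *)
Inductive polylt : nat -> (V -> R) -> Prop :=
| polylt_0 d : polylt d (fun=> 0)
| polylt_cst d c : polylt d.+1 (fun=> c)
| polyltD d p q : polylt d p -> polylt d q -> polylt d (fun x => p x + q x)
| polyltX d i p : polylt d p -> polylt d.+1 (fun x => x ord0 i * p x).

Lemma polylt0 p : polylt 0 p -> p = fun=> 0.
Proof.
suff H d : polylt d p -> d = 0%N -> p = fun=> 0 by move/H; apply.
elim=> {d p} // d p q _ IHp _ IHq d0.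
by rewrite IHp // IHq //; apply/funext => x; rewrite addr0.
Qed.

Lemma polyltZ d (c : R) p : polylt d p -> polylt d (fun x => c * p x).
Proof.
elim=> {d p} [d|d e|d p q _ IHp _ IHq|d i p _ IH].
- by under eq_fun do rewrite mulr0; exact: polylt_0.
- exact: polylt_cst.
- by under eq_fun do rewrite mulrDr; exact: polyltD.
- by under eq_fun do rewrite mulrCA; exact: polyltX.
Qed.

Lemma polyltS d p : polylt d p -> polylt d.+1 p.
Proof.
elim=> {d p} [d|d e|d p q _ IHp _ IHq|d i p _ IH].
- exact: polylt_0.
- exact: polylt_cst.
- exact: polyltD.
- exact: polyltX.
Qed.

Lemma polylt_sum d (I : Type) (s : seq I) (P : pred I) (F : I -> V -> R) :
  (forall i, P i -> polylt d (F i)) -> polylt d (fun x => \sum_(i <- s | P i) F i x).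
Proof.
move=> PF; elim: s => [|i s IH].
  by under eq_fun do rewrite big_nil; exact: polylt_0.
under eq_fun do rewrite big_cons.
by case Pi : (P i) => //=; apply: polyltD => //; exact: PF.
Qed.

Lemma polylt_shift d p h : polylt d p -> polylt d (fun x => p (x + h)).
Proof.
elim=> {d p} [d|d e|d p q _ IHp _ IHq|d i p _ IH].
- exact: polylt_0.
- exact: polylt_cst.
- exact: (polyltD IHp IHq).
- under eq_fun do rewrite mxE mulrDl.
  by apply: polyltD; [exact: (polyltX i IH)|exact/polyltS/polyltZ].
Qed.

(** The product case is the discrete Leibniz rule, where [h ord0 i * p (x + h)] has already lost the
    factor [x ord0 i]. *)
Lemma polylt_fdiff d p h : polylt d p -> polylt d.-1 (fdiff h p).
Proof.
elim=> {d p} [d|d e|d p q _ IHp _ IHq|d i p pd IH].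
- rewrite (_ : fdiff _ _ = fun=> 0); first exact: polylt_0.
  by apply/funext => x; rewrite /fdiff subrr.
- rewrite (_ : fdiff _ _ = fun=> 0); first exact: polylt_0.
  by apply/funext => x; rewrite /fdiff subrr.
- rewrite (_ : fdiff _ _ = fun x => fdiff h p x + fdiff h q x); first exact: polyltD.
  by apply/funext => x; rewrite /fdiff; ring.
- rewrite (_ : fdiff _ _ = fun x => x ord0 i * fdiff h p x + h ord0 i * p (x + h)).
    apply: polyltD; last by apply: polyltZ; exact: polylt_shift.
    (* For [d = 0] the truncated predecessor gives no gain and [polyltX] would overshoot the degree;
       there [p] is zero. *)
    case: d pd IH => [/polylt0 -> _|d pd IH]; last exact: (polyltX i IH).
    rewrite (_ : (fun x => _) = fun=> 0); first exact: polylt_0.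
    by apply/funext => x; rewrite /fdiff subrr mulr0.
  by apply/funext => x; rewrite /fdiff mxE; ring.
Qed.

Lemma polylt_mdiff d p hs : polylt d p -> polylt (d - size hs) (mdiff hs p).
Proof.
move=> pd; elim: hs => [|h hs IH]; first by rewrite subn0.
by rewrite /= subnS; exact: polylt_fdiff.
Qed.

Lemma polylt_mdiff0 d p hs x : polylt d p -> (d <= size hs)%N -> mdiff hs p x = 0.
Proof.
by move=> /(@polylt_mdiff _ _ hs) + dh; rewrite (eqP dh) => /polylt0 ->.
Qed.

(** This is the regularity on which the Whitney argument runs; unlike a global bound, it survives
    the subtraction of polynomials. *)
Definition locally_bounded f := forall B : R, exists M : R, forall x, `|x| <= B -> `|f x| <= M.

Lemma locally_boundedB f g : locally_bounded f -> locally_bounded g ->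
  locally_bounded (fun x => f x - g x).
Proof.
move=> bf bg B; have [M Mf] := bf B; have [N Ng] := bg B.
by exists (M + N) => x xB; apply: le_trans (ler_normB _ _) _; apply: lerD; auto.
Qed.

Lemma locally_bounded_mdiff hs f : locally_bounded f -> locally_bounded (mdiff hs f).
Proof.
move=> bf; elim: hs => //= h hs IH B.
have [M HM] := IH (B + `|h|); exists (M + M) => x xB.
apply: le_trans (ler_normB _ _) _; apply: lerD; apply: HM; last by rewrite ler_wpDr.
by apply: le_trans (ler_normD _ _) _; rewrite lerD2r.
Qed.

Lemma polylt_bounded d p : polylt d p -> locally_bounded p.
Proof.
elim=> {d p} [d|d e|d p q _ IHp _ IHq|d i p _ IH] B.
- by exists 0 => x _; rewrite normr0.
- by exists `|e|.
- have [M Mp] := IHp B; have [N Nq] := IHq B.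
  by exists (M + N) => x xB; apply: le_trans (ler_normD _ _) _; apply: lerD; auto.
- have [M Mp] := IH B; exists (B * M) => x xB.
  rewrite normrM; apply: ler_pM => //; last exact: Mp.
  exact: le_trans (norm_coord_le _ _) xB.
Qed.

(** The binomial coefficient of a real [t] over [a]; [nbin_diff] is Pascal's rule. *)
Definition nbin (a : nat) (t : R) : R := \prod_(k < a) ((t - k%:R) / k.+1%:R).

Lemma nbinS a t : nbin a.+1 t = nbin a t * ((t - a%:R) / a.+1%:R).
Proof. by rewrite /nbin big_ord_recr. Qed.

Lemma nbin_diff a t : nbin a.+1 (t + 1) = nbin a.+1 t + nbin a t.
Proof.
elim: a => [|a IH].
  by rewrite !nbinS /nbin !big_ord0; field.
rewrite nbinS IH [in RHS]nbinS [in RHS]nbinS.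
rewrite {1}nbinS -!natr1.
have a1 : (a%:R : R) + 1 != 0 by rewrite natr1 pnatr_eq0.
have a2 : (a%:R : R) + 1 + 1 != 0 by rewrite !natr1 pnatr_eq0.
field; rewrite a1 /=.
by move: a2; rewrite -addrA.
Qed.

Variable tau : R.
Hypothesis tau0 : 0 < tau.

Definition step (i : 'I_n) : V := tau *: delta_mx 0 i.

Lemma stepE i j : step i ord0 j = if j == i then tau else 0.
Proof. by rewrite !mxE eqxx /=; case: eqVneq => _; rewrite ?mulr1 ?mulr0. Qed.

Lemma norm_step_le i : `|step i| <= tau.
Proof.
apply: norm_row_le; first exact: ltW.
move=> j; rewrite stepE; case: eqP => _; last by rewrite normr0 ltW.
by rewrite gtr0_norm.
Qed.

(** On the grid of mesh [tau], these polynomials are to coordinate differences what monomials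
    divided by factorials are to partial derivatives. *)
Definition newton (al : 'I_n -> nat) : V -> R :=
  fun x => \prod_(i < n) nbin (al i) (x ord0 i / tau).

Lemma fdiff_newton i al : fdiff (step i) (newton al) =
  if al i is a.+1 then newton (fun k => if k == i then a else al k) else fun=> 0.
Proof.
apply/funext => x; rewrite /fdiff /newton.
rewrite (bigD1 i) //= [X in _ - X](bigD1 i) //=.
rewrite (eq_bigr (fun k => nbin (al k) (x ord0 k / tau))); last first.
  by move=> k ki; rewrite mxE stepE (negbTE ki) addr0.
rewrite mxE stepE eqxx mulrDl divff ?gt_eqF //.
case ai : (al i) => [|a]; first by rewrite /nbin !big_ord0 subrr.
rewrite nbin_diff -mulrBl addrAC subrr add0r [RHS](bigD1 i) //= eqxx.
by congr (_ * _); apply: eq_bigr => k /negbTE ->.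
Qed.

(** The induction on [a] moves the last factor of [nbin] into [p], whence the arbitrary [p] and
    [d]. *)
Lemma polylt_nbin d i a p : polylt d p -> polylt (a + d) (fun x => nbin a (x ord0 i / tau) * p x).
Proof.
elim: a d p => [|a IH] d p pd.
  by rewrite (_ : (fun x => _) = p) //; apply/funext => x; rewrite /nbin big_ord0 mul1r.
rewrite (_ : (fun x => _) = fun x => nbin a (x ord0 i / tau) *
   ((a.+1%:R^-1 / tau) * (x ord0 i * p x) + (- a%:R / a.+1%:R) * p x)).
  rewrite addSnnS; apply: IH; apply: polyltD; apply: polyltZ; last exact: polyltS.
  exact: polyltX.
by apply/funext => x; rewrite nbinS; ring.
Qed.

Lemma polylt_newton al : polylt (\sum_(i < n) al i).+1 (newton al).
Proof.
suff H (s : seq 'I_n) : polylt (\sum_(i <- s) al i).+1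
    (fun x => \prod_(i <- s) nbin (al i) (x ord0 i / tau)) by exact: H.
elim: s => [|i s IH].
  rewrite (_ : (fun x => _) = fun=> 1); first exact: polylt_cst.
  by apply/funext => x; rewrite big_nil.
rewrite big_cons -addnS (_ : (fun x => _) = fun x => nbin (al i) (x ord0 i / tau) *
    \prod_(i <- s) nbin (al i) (x ord0 i / tau)); first exact: polylt_nbin.
by apply/funext => x; rewrite big_cons.
Qed.

(** Each step in direction [i] lowers [al i] by one, or gives zero if [al i] is already 0. There are
    as many steps as the total degree, so the constant 1 is left exactly when all multiplicities
    agree. *)
Lemma mdiff_newton (w : seq 'I_n) al x : (\sum_(i < n) al i = size w)%N ->
  mdiff (map step w) (newton al) x = [forall i, count_mem i w == al i]%:R.
Proof.
elim: w al => [|i w IH] al /= szal.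
  have al0 i : al i = 0%N.
    by move/eqP: szal; rewrite sum_nat_eq0 => /forallP/(_ i)/eqP.
  rewrite /newton big1 => [|i _]; last by rewrite al0 /nbin big_ord0.
  by rewrite (_ : [forall i, _] = true) //; apply/forallP => i; rewrite al0.
rewrite fdiff_mdiff fdiff_newton; case ai : (al i) => [|a].
  rewrite mdiff0 (_ : [forall i, _] = false) //.
  by apply/negP => /forallP/(_ i); rewrite ai eqxx.
rewrite IH.
  congr (_%:R); congr nat_of_bool; apply: eq_forallb => k; rewrite eq_sym (eq_sym i).
  case: (eqVneq k i) => [->|ki]; last by rewrite add0n eq_sym.
  by rewrite ai add1n eqSS eq_sym.
apply/eqP; rewrite -eqSS -szal (bigD1 i) //= [X in _ == X](bigD1 i) //= eqxx ai addSn.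
by apply/eqP; congr (_.+1); congr addn; apply: eq_bigr => k /negbTE ->.
Qed.

Lemma sum_count (w : seq 'I_n) : (\sum_(i < n) count_mem i w = size w)%N.
Proof.
rewrite -sum1_size (eq_bigr (fun i => \sum_(j <- w | j == i) 1)%N); last first.
  by move=> i _; rewrite sum1_count.
rewrite (exchange_big_dep xpredT) //=; apply: eq_bigr => i _.
by rewrite (big_pred1 i) // => j; rewrite eq_sym.
Qed.

(** A mixed difference depends only on the multiset of its directions. The sorted tuples represent
    each multiset once, and by duality the values of the differences of [f] serve as
    coefficients. *)
Lemma match_top_differences d f : exists2 P, polylt d.+1 P &
  forall w : seq 'I_n, size w = d ->
    mdiff (map step w) P 0 = mdiff (map step w) f 0.
Proof.
pose le_n : rel 'I_n := fun i j => (i <= j)%N.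
have le_tot : total le_n by move=> i j; exact: leq_total.
have le_tr : transitive le_n by move=> i j k; exact: leq_trans.
have le_as : antisymmetric le_n by move=> i j /anti_leq /val_inj.
exists (fun x => \sum_(w : d.-tuple 'I_n | sorted le_n w)
   mdiff (map step w) f 0 * newton (fun i => count_mem i w) x).
  apply: polylt_sum => w _; apply: polyltZ.
  by have := polylt_newton (fun i => count_mem i w); rewrite sum_count size_tuple.
move=> w szw; rewrite mdiff_sum.
have szs : size (sort le_n w) == d by rewrite size_sort szw.
rewrite (bigD1 (Tuple szs)) /=; last exact: sort_sorted.
have psw : perm_eq (sort le_n w) w by rewrite perm_sort.
(* Two sorted tuples with equal multiplicities coincide, so every other summand vanishes. *)
rewrite big1 ?addr0; last first.
  move=> v /andP[vs vw]; rewrite mdiffZ mdiff_newton ?sum_count ?size_tuple //.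
  case: forallP => [cw|_]; last by rewrite mulr0.
  case/negP: vw; apply/eqP/val_inj/(sorted_eq le_tr le_as vs (sort_sorted le_tot w)).
  rewrite perm_sym (perm_trans psw) //; apply/allP => i _; exact/eqP/eqP.
rewrite mdiffZ mdiff_newton; last by rewrite sum_count size_sort.
rewrite (_ : [forall i, _] = true).
  rewrite mulr1 -(mdiff_perm _ (_ : perm_eq (map step (sort le_n w)) _)) //.
  exact: perm_map.
by apply/forallP => i; move/permP: psw => ->.
Qed.

End Polynomials.

(** * Approximately additive functions and the discrete Whitney theorem *)

Section Whitney.
Variable R : realType.

(** Let S be the supremum of [|a|] on [0, 1]; the bound [M] makes it finite. Doubling bounds [|a|]
    by (S + d) / 2 on [0, 1/2], and the reflection [1 - t] carries this to [1/2, 1] at the cost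
    [e + d]. Hence S is at most 2e + 3d, and passing to negative [t] costs another 2d. *)
Lemma approx_additive_line (a : R -> R) (d e M : R) :
  (forall t u, `|t| <= 1 -> `|u| <= 1 -> `|a (t + u) - a t - a u| <= d) ->
  (forall t, `|t| <= 1 -> `|a t| <= M) -> `|a 1| <= e ->
  forall t, `|t| <= 1 -> `|a t| <= 2 * e + 5 * d.
Proof.
move=> add_a aM a1.
pose A := [set `|a t| | t in [set t : R | 0 <= t <= 1]].
have A0 : A !=set0 by exists `|a 0|, 0 => //=; rewrite lexx ler01.
have leS t : 0 <= t <= 1 -> `|a t| <= sup A.
  move=> t01; apply: sup_upper_bound; last by exists t.
  split=> //; exists M => _ [u /= /andP[u0 u1] <-].
  by apply: aM; rewrite ger0_norm.
have half t : 0 <= t <= 2^-1 -> `|a t| <= (sup A + d) / 2.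
  move=> /andP[t0 t1]; have tn : `|t| <= 1 by rewrite ger0_norm //; lra.
  have := add_a t t tn tn; have := leS (t + t) ltac:(apply/andP; split; lra).
  rewrite !ler_norml => /andP[? ?] /andP[? ?]; apply/andP; split; lra.
have all01 t : 0 <= t <= 1 -> `|a t| <= e + d + (sup A + d) / 2.
  move=> /andP[t0 t1]; have [th|th] := leP t 2^-1.
    have := half t ltac:(apply/andP; split; lra).
    have : 0 <= d by apply: le_trans (add_a 0 0 _ _); rewrite ?normr0.
    have : 0 <= e by apply: le_trans a1.
    lra.
  have tn : `|t| <= 1 by rewrite ger0_norm.
  have sn : `|1 - t| <= 1 by rewrite ger0_norm; lra.
  have := add_a t (1 - t) tn sn; have := half (1 - t) ltac:(apply/andP; split; lra).
  move: a1; rewrite (_ : t + (1 - t) = 1); last by ring.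
  rewrite !ler_norml => /andP[? ?] /andP[? ?] /andP[? ?]; apply/andP; split; lra.
have supA : sup A <= e + d + (sup A + d) / 2.
  by apply: sup_le_ub => // _ [t t01 <-]; exact: all01.
have n0 : `|0 : R| <= 1 by rewrite normr0.
have := add_a 0 0 n0 n0; rewrite addr0 => a0.
have d0 : 0 <= d by apply: le_trans a0.
move=> t tn; have [t0|t0] := leP 0 t.
  by have := leS t; rewrite t0 -(ger0_norm t0) tn => /(_ isT); lra.
have ntn : `|- t| <= 1 by rewrite normrN.
have := add_a t (- t) tn ntn; rewrite subrr.
have := leS (- t); rewrite oppr_ge0 (ltW t0) /=.
move: tn; rewrite ltr0_norm // => -> /(_ isT).
move: a0; rewrite !ler_norml => /andP[? ?] /andP[? ?] /andP[? ?]; apply/andP; split; lra.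
Qed.

Variable n : nat.
Local Notation V := 'rV[R]_n.
Implicit Types (h x : V) (hs : seq V) (f q : V -> R).

(** The previous lemma bounds [b] on each axis by 2e + 5d. Assembling [h] coordinate by coordinate
    costs one more [d] each time, and the leading [d] bounds [b 0]. *)
Lemma approx_additive_le (b : V -> R) (tau d e : R) : 0 < tau ->
  (forall h k, `|h| <= tau -> `|k| <= tau -> `|b (h + k) - b h - b k| <= d) ->
  locally_bounded b -> (forall i, `|b (step tau i)| <= e) ->
  forall h, `|h| <= tau -> `|b h| <= d + n%:R * (2 * e + 6 * d).
Proof.
move=> tau0 add_b bb be h htau.
have [M HM] := bb tau.
have line i t : `|t| <= tau -> `|b (t *: delta_mx 0 i)| <= 2 * e + 5 * d.
  move=> ttau.
  have norm_ts (u : R) : `|u| <= 1 -> `|u *: step tau i : V| <= tau.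
    move=> u1; rewrite normrZ; apply: le_trans (norm_step_le tau0 i).
    by rewrite ler_piMl.
  have -> : t *: delta_mx 0 i = (t / tau) *: step tau i.
    by rewrite /step scalerA divfK // gt_eqF.
  apply: (@approx_additive_line (fun u => b (u *: step tau i)) d e M).
  - by move=> u v u1 v1; rewrite scalerDl; apply: add_b; exact: norm_ts.
  - by move=> u u1; apply: HM; exact: norm_ts.
  - by rewrite scale1r; exact: be.
  - by rewrite normrM normfV (gtr0_norm tau0) ler_pdivrMr // mul1r.
(* [tr k] keeps the first [k] coordinates of [h]; truncation does not increase the sup norm. *)
pose tr k : V := \row_j (if (j < k)%N then h ord0 j else 0).
have trtau k : `|tr k| <= tau.
  apply: le_trans htau; apply: norm_row_le => // j; rewrite mxE.
  by case: ifP => _; [exact: norm_coord_le|rewrite normr0].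
have d0 : 0 <= d.
  have := add_b 0 0; rewrite normr0 (ltW tau0) => /(_ isT isT).
  exact: le_trans.
suff H k : (k <= n)%N -> `|b (tr k)| <= d + k%:R * (2 * e + 6 * d).
  have -> : h = tr n by apply/rowP => j; rewrite mxE ltn_ord.
  exact: H.
elim: k => [_|k IH kn].
  have -> : tr 0%N = 0 by apply/rowP => j; rewrite !mxE.
  have := add_b 0 0; rewrite normr0 addr0 (ltW tau0) => /(_ isT isT).
  by rewrite subrr sub0r normrN mul0r addr0.
have -> : tr k.+1 = tr k + h ord0 (Ordinal kn) *: delta_mx 0 (Ordinal kn).
  apply/rowP => j; rewrite !mxE /= ltnS leq_eqVlt.
  have -> : (j == Ordinal kn) = (j == k :> nat) by [].
  case: (eqVneq (j : nat) k) => [jk|_].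
    rewrite jk ltnn add0r mulr1; congr (h _ _); exact: val_inj.
  by rewrite mulr0 addr0.
have hk : `|h ord0 (Ordinal kn)| <= tau by exact: le_trans (norm_coord_le _ _) htau.
have ek : `|h ord0 (Ordinal kn) *: delta_mx 0 (Ordinal kn) : V| <= tau.
  apply: norm_row_le => [|j]; first exact: ltW.
  rewrite !mxE eqxx /=; case: eqP => _; first by rewrite mulr1.
  by rewrite mulr0 normr0 ltW.
have := add_b _ _ (trtau k) ek; have := line (Ordinal kn) _ hk.
have := IH (ltnW kn); rewrite -natr1 mulrDl mul1r.
rewrite !ler_norml => /andP[? ?] /andP[? ?] /andP[? ?]; apply/andP; split; lra.
Qed.

Definition mdiff_bound (r : nat) (tau rho d : R) f :=
  forall hs x, size hs = r -> {in hs, forall h : V, `|h| <= tau} -> `|x| <= rho ->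
    `|mdiff hs f x| <= d.

(** The recursion is the bound of [approx_additive_le] with [e] equal to the previous constant times
    [d]. *)
Fixpoint whitney_cst0 (k : nat) : R :=
  if k is k'.+1 then 1 + n%:R * (2 * whitney_cst0 k' + 6) else 0.

(** The induction is on the number [k] of free steps, the others being coordinate steps. As a
    function of one free step, the difference at 0 is approximately additive, and its values on
    coordinate steps are controlled by the case of one free step fewer. *)
Lemma mdiff_at0_le r (tau rho d : R) q : 0 < tau -> 0 <= rho ->
  locally_bounded q -> mdiff_bound r.+1 tau rho d q ->
  (forall w, size w = r -> mdiff (map (step tau) w) q 0 = 0) ->
  forall k hs w, size hs = k -> (k + size w = r)%N ->
  {in hs, forall h : V, `|h| <= tau} ->
  `|mdiff (hs ++ map (step tau) w) q 0| <= whitney_cst0 k * d.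
Proof.
move=> tau0 rho0 bq Hq q0; elim=> [|k IH] hs w.
  by case: hs => // _ szw _; rewrite mul0r q0 ?normr0.
case: hs => // h hs [szh] szw hst /=.
have {}hst_tl : {in hs, forall h : V, `|h| <= tau}.
  by move=> h' h'hs; apply: hst; rewrite inE h'hs orbT.
set s := hs ++ map (step tau) w.
have szs : size s = (k + size w)%N by rewrite size_cat size_map szh.
have smt : {in s, forall h : V, `|h| <= tau}.
  move=> h'; rewrite mem_cat => /orP[/hst_tl //|/mapP[i _ ->]].
  exact: norm_step_le.
rewrite (_ : (1 + _) * d = d + n%:R * (2 * (whitney_cst0 k * d) + 6 * d)); last ring.
apply: (@approx_additive_le (fun h => fdiff h (mdiff s q) 0) tau) => //.
- move=> h1 h2 h1t h2t.
  (* The defect of additivity is itself a mixed difference, of order [r + 1]. *)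
  have -> : fdiff (h1 + h2) (mdiff s q) 0 - fdiff h1 (mdiff s q) 0 - fdiff h2 (mdiff s q) 0
      = mdiff [:: h1, h2 & s] q 0.
    rewrite !mdiff_cons /fdiff !add0r; ring.
  apply: Hq; rewrite ?normr0 //=; first by rewrite szs -szw.
  by move=> h'; rewrite !inE => /or3P[/eqP -> //|/eqP -> //|/smt].
- rewrite /fdiff => B; have [M HM] := locally_bounded_mdiff s bq B.
  exists (M + `|mdiff s q 0|) => x xB; rewrite add0r.
  by apply: le_trans (ler_normB _ _) _; rewrite lerD2r HM.
- move=> i; have := IH hs (i :: w) szh; rewrite addnS => /(_ szw hst_tl).
  rewrite (@mdiff_perm _ _ _ (step tau i :: s)) //.
  by rewrite /s /= -cat1s perm_catCA.
- by apply: hst; rewrite mem_head.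
Qed.

(** Subtracting [P] makes the differences of order [r] along coordinate steps vanish at 0, so all of
    them are small at 0. They are then carried to [x] in [K] moves of length at most [tau], each
    costing one difference of order [r + 1]. *)
Lemma mdiff_bound_pred r (tau rho d : R) (K : nat) f :
  0 < tau -> 0 <= rho -> rho <= K%:R * tau ->
  locally_bounded f -> mdiff_bound r.+1 tau rho d f ->
  exists2 P, polylt r.+1 P &
    mdiff_bound r tau rho ((whitney_cst0 r + K%:R) * d) (fun x => f x - P x).
Proof.
move=> tau0 rho0 rhoK bf Hf.
have [P Pr topP] := match_top_differences tau0 r f.
exists P => //; set q := fun x => _.
have bq : locally_bounded q by apply: locally_boundedB => //; exact: polylt_bounded Pr.
have Hq : mdiff_bound r.+1 tau rho d q.
  move=> hs x szh hst xrho; rewrite /q mdiffB (polylt_mdiff0 _ Pr) ?szh // subr0.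
  exact: Hf.
have q0 w : size w = r -> mdiff (map (step tau) w) q 0 = 0.
  by move=> szw; rewrite /q mdiffB topP // subrr.
move=> hs x szh hst xrho.
have at0 : `|mdiff hs q 0| <= whitney_cst0 r * d.
  rewrite -[hs]cats0 -[[::]]/(map (step tau) [::]).
  by apply: (mdiff_at0_le tau0 rho0 bq Hq) => //; rewrite addn0.
(* If [K = 0], then [rho] is 0 and [x] is the origin. *)
have [K0|K0] := posnP K.
  have x0 : x = 0.
    by apply/normr0_eq0/eqP; rewrite eq_le normr_ge0 (le_trans xrho) // (le_trans rhoK) // K0 mul0r.
  by rewrite K0 addr0 x0.
have KR : (0 : R) < K%:R by rewrite ltr0n.
pose y := K%:R^-1 *: x.
have yt : `|y| <= tau.
  rewrite /y normrZ normfV normr_nat mulrC ler_pdivrMr // mulrC.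
  exact: le_trans xrho rhoK.
suff H l : (l <= K)%N -> `|mdiff hs q (l%:R *: y)| <= (whitney_cst0 r + l%:R) * d.
  have -> : x = K%:R *: y by rewrite /y scalerA mulfV ?scale1r // gt_eqF.
  exact: H.
elim: l => [_|l IH lK]; first by rewrite scale0r addr0.
have -> : mdiff hs q (l.+1%:R *: y) = mdiff (y :: hs) q (l%:R *: y) + mdiff hs q (l%:R *: y).
  by rewrite mdiff_cons subrK -natr1 scalerDl scale1r.
rewrite -natr1 addrA mulrDl mul1r [leRHS]addrC; apply: le_trans (ler_normD _ _) _.
apply: lerD; last by rewrite IH // ltnW.
apply: Hq; first by rewrite /= szh.
  by move=> h; rewrite inE => /orP[/eqP ->|/hst].
rewrite /y scalerA normrZ ger0_norm; last by rewrite divr_ge0 ?ler0n.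
apply: le_trans xrho; rewrite ler_piMl // ler_pdivrMr // mul1r ler_nat.
exact: ltnW.
Qed.

Fixpoint whitney_cst (K r : nat) : R :=
  if r is r'.+1 then whitney_cst K r' * (whitney_cst0 r' + K%:R) else 1.

Lemma whitney_cst_ge0 K r : 0 <= whitney_cst K r.
Proof.
have cst0_ge0 k : 0 <= whitney_cst0 k.
  by elim: k => //= k IH; rewrite addr_ge0 // mulr_ge0 // addr_ge0 // mulr_ge0.
by elim: r => //= r IH; rewrite mulr_ge0 // addr_ge0.
Qed.

(** Each induction step subtracts a polynomial that lowers the order of the small differences by
    one, and [whitney_cst] multiplies up the losses. At order 0 the hypothesis bounds [f] itself. *)
Lemma discrete_whitney r (tau rho d : R) (K : nat) f :
  0 < tau -> 0 <= rho -> rho <= K%:R * tau ->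
  locally_bounded f -> mdiff_bound r tau rho d f ->
  exists2 P, polylt r P & forall x, `|x| <= rho -> `|f x - P x| <= whitney_cst K r * d.
Proof.
move=> tau0 rho0 rhoK; elim: r d f => [|r IH] d f bf Hf.
  exists (fun=> 0); first exact: polylt_0.
  by move=> x xrho; rewrite subr0 mul1r; apply: (Hf [::]).
have [P Pr HP] := mdiff_bound_pred tau0 rho0 rhoK bf Hf.
have bP := polylt_bounded Pr.
have [Q Qr HQ] := IH _ _ (locally_boundedB bf bP) HP.
exists (fun x => P x + Q x); first by apply: polyltD => //; exact: polyltS.
by move=> x xrho; rewrite opprD addrA /= -mulrA; exact: HQ.
Qed.

End Whitney.

(** * One-dimensional integrals of continuous functions with compact support *)

Section Integration1.
Variable R : realType.
Notation mu := (@lebesgue_measure R).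
Implicit Types F G : R -> R.

Definition cc1 (B : R) F := [/\ 0 <= B, continuous F & forall t, B < `|t| -> F t = 0].

Lemma Rintegral_supp (a b : R) F : (forall t, ~~ (a <= t <= b) -> F t = 0) ->
  \int[mu]_t F t = \int[mu]_(t in `[a, b]) F t.
Proof.
move=> F0; rewrite [RHS]Rintegral_mkcond; congr Rintegral; apply/funext => t.
rewrite patchE; case: ifPn => //; rewrite notin_setE /= in_itv /= => /negP.
exact: F0.
Qed.

Lemma cc1_itv B F t : cc1 B F -> ~~ (- B <= t <= B) -> F t = 0.
Proof. by case=> _ _ F0; rewrite -ler_norml -ltNge; exact: F0. Qed.

Lemma cc1_integrable B F : cc1 B F -> mu.-integrable setT (EFin \o F).
Proof.
move=> ccF; have -> : EFin \o F = (EFin \o F) \_ `[- B, B].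
  apply/funext => t; rewrite patchE; case: ifPn => //.
  by rewrite notin_setE /= in_itv /= => /negP /(cc1_itv ccF) ->.
rewrite -integrable_mkcond //.
apply: continuous_compact_integrable; first exact: segment_compact.
by case: ccF => _ cF _; exact: continuous_subspaceT.
Qed.

Lemma cc1_le B (M : R) F : cc1 B F -> (forall t, `|F t| <= M) ->
  `|\int[mu]_t F t| <= 2 * B * M.
Proof.
move=> ccF FM; have B0 : 0 <= B by case: ccF.
rewrite (Rintegral_supp (fun t => cc1_itv ccF (t := t))).
have iF : mu.-integrable `[- B, B] (EFin \o F).
  exact: integrableS (cc1_integrable ccF).
apply: le_trans (le_normr_Rintegral _ iF) _ => //.
apply: (@le_trans _ _ (\int[mu]_(t in `[- B, B]) M)).
  apply: le_Rintegral => //.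
    exact: integrable_norm iF.
  apply: continuous_compact_integrable; first exact: segment_compact.
  by apply: continuous_subspaceT => t; exact: cvg_cst.
rewrite Rintegral_cst //= lebesgue_measure_itv /= lte_fin.
case: ifPn => [_|]; first by rewrite /= le_eqVlt; apply/orP; left; apply/eqP; ring.
rewrite -leNgt => BB; have -> : B = 0 by lra.
by rewrite /= !(mulr0, mul0r).
Qed.

(** Compact support reduces the change of variables to one between segments, with [[al, be]] the
    preimage of [[- B, B]] under [G]. *)
Lemma Rintegral_affine B F (a b : R) : 0 < a -> cc1 B F ->
  \int[mu]_t F (a * t + b) = a^-1 * \int[mu]_t F t.
Proof.
move=> a0 ccF; have [B0 cF F0] := ccF.
pose G := fun t => a * t + b.
have dG (t : R) : is_derive t (1 : R) G a.
  rewrite /G; apply: is_derive_eq; rewrite addr0; exact: mulr1.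
have G' : derive1 G = cst a by apply/funext => t; rewrite derive1E derive_val.
have cG : continuous G.
  move=> t; apply: differentiable_continuous; apply/derivable1_diffP.
  by have [] := dG t.
pose al := (- B - b) / a; pose be := (B - b) / a.
have Gal : G al = - B by rewrite /G /al mulrC divfK ?gt_eqF // subrK.
have Gbe : G be = B by rewrite /G /be mulrC divfK ?gt_eqF // subrK.
have albe : al <= be by rewrite /al /be ler_pM2r ?invr_gt0 //; lra.
rewrite [in LHS](@Rintegral_supp al be); last first.
  move=> t /negP tI; apply: (cc1_itv ccF); apply/negP => /andP[t1 t2]; apply: tI.
  rewrite /al /be ler_pdivrMr // ler_pdivlMr // mulrC; apply/andP; split; lra.
rewrite (Rintegral_supp (fun t => cc1_itv ccF (t := t))).
have cFG : continuous (F \o G) by move=> t; apply: continuous_comp; [exact: cG|exact: cF].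
have -> : \int[mu]_(t in `[- B, B]) F t = \int[mu]_(t in `[al, be]) (a * F (a * t + b)).
  rewrite -Gal -Gbe /Rintegral; congr fine.
  rewrite (@integration_by_substitution_increasing _ G) //.
  - by apply: eq_integral => t _ /=; rewrite G' /cst /= fctE /= mulrC.
  - by move=> x y _ _ xy; rewrite /G ltrD2r ltr_pM2l.
  - by rewrite G' => ? _; exact: cvg_cst.
  - by rewrite G'; exact: is_cvg_cst.
  - by rewrite G'; exact: is_cvg_cst.
  - split.
    + by move=> t _; have [] := dG t.
    + exact: cvg_at_right_filter (cG _).
    + exact: cvg_at_left_filter (cG _).
  - exact: continuous_subspaceT.
rewrite RintegralZl //; first by rewrite mulrA mulVf ?gt_eqF // mul1r.
apply: continuous_compact_integrable; first exact: segment_compact.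
exact: continuous_subspaceT.
Qed.

End Integration1.

(** * Linearity, size and affine change of variables for the iterated integral *)

Section IteratedIntegral.
Variable R : realType.
Notation mu := (@lebesgue_measure R).

Definition cc m (B : R) (f : 'rV[R]_m -> R) :=
  [/\ 0 <= B, continuous f & forall x, B < `|x| -> f x = 0].

Lemma ccD m B (f g : 'rV[R]_m -> R) : cc B f -> cc B g -> cc B (fun x => f x + g x).
Proof.
move=> [B0 cf f0] [_ cg g0]; split=> // [x|x Bx]; last by rewrite f0 ?g0 ?addr0.
by apply: (@continuousD _ _ _ f g); [exact: cf|exact: cg].
Qed.

Lemma ccM m B (f g : 'rV[R]_m -> R) : continuous f -> cc B g -> cc B (fun x => f x * g x).
Proof.
move=> cf [B0 cg g0]; split=> // [x|x Bx]; last by rewrite g0 ?mulr0.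
by apply: (@continuousM _ _ f g); [exact: cf|exact: cg].
Qed.

Lemma ccZ m B c (f : 'rV[R]_m -> R) : cc B f -> cc B (fun x => c * f x).
Proof. by move=> ccf; apply: (@ccM _ _ (fun=> c)) => //; exact: cst_continuous. Qed.

Lemma rcons0_0 m t (y : 'rV[R]_m) : rcons0 t y ord0 ord0 = t.
Proof. by rewrite mxE unlift_none. Qed.

Lemma rcons0_lift m t (y : 'rV[R]_m) j : rcons0 t y ord0 (lift ord0 j) = y ord0 j.
Proof. by rewrite mxE liftK. Qed.

Lemma norm_rcons0_le m t (y : 'rV[R]_m) (e : R) :
  `|t| <= e -> `|y| <= e -> `|rcons0 t y| <= e.
Proof.
move=> te ye; apply: norm_row_le => [|i]; first exact: le_trans te.
case: (unliftP ord0 i) => [j|] ->; rewrite ?rcons0_0 ?rcons0_lift //.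
exact: le_trans (norm_coord_le _ _) ye.
Qed.

Lemma rcons0B m t u (y z : 'rV[R]_m) : rcons0 t y - rcons0 u z = rcons0 (t - u) (y - z).
Proof.
apply/rowP => i; rewrite !mxE.
by case: (unlift ord0 i) => // j; rewrite !mxE.
Qed.

Lemma continuous_rcons0 m : continuous (fun p : R * 'rV[R]_m => rcons0 p.1 p.2).
Proof.
move=> [t y]; apply/cvgrPdist_le => /= e e0; near=> p.
rewrite rcons0B; apply: norm_rcons0_le; near: p.
  have : (fun p : R * 'rV[R]_m => p.1) x @[x --> (t, y)] --> t by exact: cvg_fst.
  by move/cvgrPdist_le; apply.
have : (fun p : R * 'rV[R]_m => p.2) x @[x --> (t, y)] --> y by exact: cvg_snd.
by move/cvgrPdist_le; apply.
Unshelve. all: by end_near. Qed.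

Lemma continuous_rcons0r m t : continuous (fun y : 'rV[R]_m => rcons0 t y).
Proof.
move=> y; apply/(@cvgrPdist_le _ _ _ _ (nbhs_filter y)) => e e0; near=> z.
rewrite rcons0B subrr; apply: norm_rcons0_le; first by rewrite normr0 ltW.
near: z.
by apply: ((cvgrPdist_le (FF := nbhs_filter y) id y).1 cvg_id).
Unshelve. all: by end_near. Qed.

Lemma cc_slice m B (f : 'rV[R]_m.+1 -> R) t : cc B f -> cc B (fun y => f (rcons0 t y)).
Proof.
move=> [B0 cf f0]; split=> // [y|y By].
  by apply: continuous_comp; [exact: continuous_rcons0r|exact: cf].
apply: f0; apply: lt_le_trans By _; apply: norm_row_le => // i.
by rewrite -(rcons0_lift t y i); exact: norm_coord_le.
Qed.

Lemma slice_eq0 m B (f : 'rV[R]_m.+1 -> R) t : cc B f -> B < `|t| ->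
  (fun y => f (rcons0 t y)) = fun=> 0.
Proof.
move=> [B0 _ f0] Bt; apply/funext => y; apply: f0; apply: lt_le_trans Bt _.
by rewrite -{1}(rcons0_0 t y); exact: norm_coord_le.
Qed.

Lemma iint0 m : iint (fun _ : 'rV[R]_m => 0) = 0.
Proof.
elim: m => //= m IH; rewrite (_ : (fun t => _) = fun=> 0).
  by rewrite Rintegral_cst // mul0r.
by apply/funext => t.
Qed.

Lemma compact_ball0 m (B : R) : compact [set y : 'rV[R]_m | `|y| <= B].
Proof.
apply: bounded_closed_compact.
  by exists B; split; [exact: num_real|move=> M BM y /= /le_trans; apply; exact: ltW].
apply: (@closed_comp _ _ (fun y : 'rV[R]_m => `|y|) [set t | t <= B]).
  by move=> y _; exact: norm_continuous.
exact: closed_le.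
Qed.

(* Tube lemma: the slices converge uniformly on the compact support. *)
Lemma slice_near m B (f : 'rV[R]_m.+1 -> R) t0 (e : R) : cc B f -> 0 < e ->
  \forall t \near t0, forall y, `|f (rcons0 t0 y) - f (rcons0 t y)| <= e.
Proof.
move=> ccf e0; have [B0 cf f0] := ccf.
have cF : continuous (fun p : R * 'rV[R]_m => f (rcons0 p.1 p.2)).
  by move=> p; apply: continuous_comp; [exact: continuous_rcons0|exact: cf].
have cov : near_covering [set y : 'rV[R]_m | `|y| <= B].
  exact/compact_near_coveringP/compact_ball0.
have H : \forall t \near t0, [set y : 'rV[R]_m | `|y| <= B] `<=`
    (fun y => `|f (rcons0 t0 y) - f (rcons0 t y)| <= e).
  apply: (cov _ (nbhs t0) (fun t y => `|f (rcons0 t0 y) - f (rcons0 t y)| <= e)).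
  move=> y _.
  (* Both [(t0, z)] and [(t, z)] are compared with [(t0, y)], so half of [e] is spent on each. *)
  have e2 : 0 < e / 2 by rewrite divr_gt0.
  have [[U1 U2] /= [U1t U2y] HU] := (cvgrPdist_le _ _).1 (cF (t0, y)) _ e2.
  exists (U2, U1) => //= -[z t] /= [U2z U1t'].
  have := HU (t0, z) (conj (nbhs_singleton U1t) U2z).
  have := HU (t, z) (conj U1t' U2z) => /=.
  rewrite !ler_norml => /andP[? ?] /andP[? ?]; apply/andP; split; lra.
apply: filterS H => t Ht y; have [yB|yB] := leP `|y| B; first exact: Ht.
have [_ _ fs] := cc_slice t ccf; have [_ _ fs0] := cc_slice t0 ccf.
by rewrite fs // fs0 // subrr normr0 ltW.
Qed.

(** The first three hypotheses are the induction hypotheses of [iint_props]. With them, uniform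
    convergence of the slices gives continuity of their integrals. *)
Lemma cc_iint_slice m B (f : 'rV[R]_m.+1 -> R) :
  (forall g h : 'rV[R]_m -> R, cc B g -> cc B h ->
     iint (fun x => g x + h x) = iint g + iint h) ->
  (forall c (g : 'rV[R]_m -> R), cc B g -> iint (fun x => c * g x) = c * iint g) ->
  (forall M (g : 'rV[R]_m -> R), cc B g -> (forall x, `|g x| <= M) ->
     `|iint g| <= (2 * B) ^+ m * M) ->
  cc B f -> cc1 B (fun t => iint (fun y => f (rcons0 t y))).
Proof.
move=> iD iZ iM ccf; have [B0 _ _] := ccf; split=> // [t0|t Bt]; last first.
  by rewrite (slice_eq0 ccf Bt) iint0.
apply/cvgrPdist_le => e e0.
(* The added 1 keeps the divisor positive even when [B = 0]. *)
have C0 : 0 < (2 * B) ^+ m + 1 by rewrite ltr_wpDl // exprn_ge0 // mulr_ge0.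
have d0 : 0 < e / ((2 * B) ^+ m + 1) by rewrite divr_gt0.
apply: filterS (slice_near t0 ccf d0) => t Ht.
have cct := ccZ (-1) (cc_slice t ccf).
have -> : iint (fun y => f (rcons0 t0 y)) - iint (fun y => f (rcons0 t y)) =
    iint (fun y => f (rcons0 t0 y) + -1 * f (rcons0 t y)).
  rewrite iD //; last exact: cc_slice.
  by rewrite iZ ?mulN1r //; exact: cc_slice.
apply: le_trans (iM (e / ((2 * B) ^+ m + 1)) _ _ _) _.
- by apply: ccD => //; exact: cc_slice.
- by move=> y; rewrite mulN1r; exact: Ht.
- rewrite mulrCA; apply: ler_piMr; first exact: ltW.
  by rewrite ler_pdivrMr // mul1r lerDl.
Qed.

(** The three properties are proved together: each in dimension [m + 1] relies on integrability of
    the slice integrals, which rests on all three in dimension [m]. *)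
Lemma iint_props m B :
  [/\ (forall f g : 'rV[R]_m -> R, cc B f -> cc B g ->
         iint (fun x => f x + g x) = iint f + iint g),
      (forall c (f : 'rV[R]_m -> R), cc B f -> iint (fun x => c * f x) = c * iint f) &
      (forall M (f : 'rV[R]_m -> R), cc B f -> (forall x, `|f x| <= M) ->
         `|iint f| <= (2 * B) ^+ m * M)].
Proof.
elim: m => [|m [iD iZ iM]].
  by split=> // M f _ fM; rewrite expr0 mul1r; exact: fM.
have cci f := @cc_iint_slice m B f iD iZ iM.
split=> [f g ccf ccg|c f ccf|M f ccf fM] /=.
- rewrite -(RintegralD _ (cc1_integrable (cci _ ccf)) (cc1_integrable (cci _ ccg))) //.
  by congr Rintegral; apply/funext => t; rewrite iD //; exact: cc_slice.
- rewrite -(RintegralZl _ _ (cc1_integrable (cci _ ccf))) //.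
  by congr Rintegral; apply/funext => t; rewrite iZ //; exact: cc_slice.
- rewrite exprS -mulrA; apply: cc1_le; first exact: cci.
  by move=> t; apply: iM => //; exact: cc_slice.
Qed.

Lemma iintD m B (f g : 'rV[R]_m -> R) : cc B f -> cc B g ->
  iint (fun x => f x + g x) = iint f + iint g.
Proof. by have [+ _ _] := iint_props m B; apply. Qed.

Lemma iintZ m B c (f : 'rV[R]_m -> R) : cc B f -> iint (fun x => c * f x) = c * iint f.
Proof. by have [_ + _] := iint_props m B; apply. Qed.

Lemma iint_le m B M (f : 'rV[R]_m -> R) : cc B f -> (forall x, `|f x| <= M) ->
  `|iint f| <= (2 * B) ^+ m * M.
Proof. by have [_ _ +] := iint_props m B; apply. Qed.

Lemma iint_affine m B (f : 'rV[R]_m -> R) (a : R) (b : 'rV[R]_m) : 0 < a -> cc B f ->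
  iint (fun x => f (a *: x + b)) = a ^- m * iint f.
Proof.
move=> a0; elim: m f b => [|m IH] f b ccf.
  rewrite /= expr0 invr1 mul1r; congr f; apply/rowP => -[] //.
rewrite /=.
pose G t := iint (fun y => f (rcons0 t y)).
have ccG : cc1 B G.
  by have [? ? ?] := iint_props m B; exact: cc_iint_slice.
have ccaG : cc1 B (fun t => a ^- m * G t).
  have [B0 cG G0] := ccG; split=> // [t|t Bt]; last by rewrite G0 ?mulr0.
  by apply: cvgM; [exact: cvg_cst|exact: cG].
rewrite (_ : (fun t => _) = fun t => a ^- m * G (a * t + b ord0 ord0)).
  rewrite (Rintegral_affine _ a0 ccaG) (RintegralZl _ _ (cc1_integrable ccG)) //.
  by rewrite mulrA exprS invfM.
apply/funext => t; rewrite -(IH _ (\row_j b ord0 (lift ord0 j))); last exact: cc_slice.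
congr iint; apply/funext => y; congr f; apply/rowP => i; rewrite !mxE.
by case: (unliftP ord0 i) => [j|] -> //; rewrite !mxE.
Qed.

End IteratedIntegral.

(** * Vanishing moments, the bound of one coefficient, and norm estimates *)

Section WaveletCoefficients.
Variables (R : realType) (n : nat).
Local Notation V := 'rV[R]_n.
Implicit Types (h x : V) (f g psi : V -> R).

Lemma continuous_locally_bounded f : continuous f -> locally_bounded f.
Proof.
move=> cf B.
have /compact_bounded [M [_ HM]] : compact (f @` [set x | `|x| <= B]).
  by apply: continuous_compact; [exact: continuous_subspaceT|exact: compact_ball0].
by exists (M + 1) => x xB; apply: HM; [rewrite ltrDl|exists x].
Qed.

Lemma polylt_continuous d p : @polylt R n d p -> continuous p.
Proof.
elim=> {d p} [d|d e|d p q _ IHp _ IHq|d i p _ IH] x.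
- exact: cst_continuous.
- exact: cst_continuous.
- by apply: (@continuousD _ _ _ p q); [exact: IHp|exact: IHq].
- apply: (@continuousM _ _ (fun x : V => x ord0 i) p); last exact: IH.
  exact: coord_continuous.
Qed.

Lemma compact_support_cc g : continuous g -> compact_support g -> exists B : R, cc B g.
Proof.
move=> cg /compact_bounded [M [_ HM]].
exists (Num.max 0 (M + 1)); split=> // [|x]; first by rewrite le_max lexx.
rewrite gt_max => /andP[_ Mx]; apply/eqP/negPn/negP => gx.
have MM : M < M + 1 by rewrite ltrDl.
have xcl : closure [set y | g y != 0] x by exact: subset_closure.
by have := HM _ MM x xcl; rewrite /= leNgt Mx.
Qed.

Lemma cc_widen B B' g : B <= B' -> cc B g -> cc B' g.
Proof.
move=> BB [B0 cg g0]; split=> // [|x Bx]; first exact: le_trans BB.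
by apply: g0; exact: le_lt_trans Bx.
Qed.

Lemma cc_bounded B g : cc B g -> exists2 M : R, 0 <= M & forall x, `|g x| <= M.
Proof.
move=> [B0 cg g0]; have [M HM] := continuous_locally_bounded cg B.
have M0 : 0 <= M by apply: le_trans (HM 0 _); rewrite ?normr0.
exists M => // x; have [/HM //|Bx] := leP `|x| B.
by rewrite g0 // normr0.
Qed.

Lemma continuous_monomial (al : 'I_n -> nat) :
  continuous (fun x : V => \prod_(i < n) x ord0 i ^+ al i).
Proof.
suff H (s : seq 'I_n) : continuous (fun x : V => \prod_(i <- s) x ord0 i ^+ al i) by exact: H.
elim: s => [|i s IH] x.
  rewrite (_ : (fun x => _) = fun=> 1); first exact: cst_continuous.
  by apply/funext => y; rewrite big_nil.
rewrite (_ : (fun x => _) = fun x : V => (x ord0 i ^+ al i) *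
    \prod_(i <- s) x ord0 i ^+ al i); last by apply/funext => y; rewrite big_cons.
apply: (@continuousM _ _ (fun x : V => x ord0 i ^+ al i)); last exact: IH.
apply: (@continuous_comp _ _ _ (fun x : V => x ord0 i) (fun t : R => t ^+ al i)).
  exact: coord_continuous.
exact: exprn_continuous.
Qed.

(** The claim is strengthened by a monomial factor: the induction over [polylt] hands each
    coordinate factor of the polynomial to that monomial, while [d] counts the degree still
    available. *)
Lemma polylt_moment (L : nat) B psi : cc B psi ->
  (forall al : 'I_n -> nat, (\sum_(i < n) al i <= L)%N ->
     iint (fun x => (\prod_(i < n) x ord0 i ^+ al i) * psi x) = 0) ->
  forall d p, polylt d p -> (d <= L.+1)%N -> iint (fun x => p x * psi x) = 0.
Proof.
move=> ccpsi mom d p pd dL.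
suff H al : (\sum_(i < n) al i + d <= L.+1)%N ->
    iint (fun x => (\prod_(i < n) x ord0 i ^+ al i) * (p x * psi x)) = 0.
  rewrite -[RHS](H (fun=> 0%N)); last by rewrite sum_nat_const muln0.
  congr iint; apply/funext => x.
  by rewrite big1 ?mul1r // => i _; rewrite expr0.
elim: pd al {dL} => {d p} [d|d e|d p q pd IHp qd IHq|d i p pd IH] al dL.
- rewrite -[RHS](iint0 R n); congr iint; apply/funext => x.
  by rewrite mul0r mulr0.
- have := iintZ e (ccM (@continuous_monomial al) ccpsi).
  rewrite mom ?mulr0; last by move: dL; rewrite addnS ltnS; apply: leq_trans; exact: leq_addr.
  by move=> <-; congr iint; apply/funext => x; rewrite mulrCA.
- have cp := polylt_continuous pd; have cq := polylt_continuous qd.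
  have cm := @continuous_monomial al.
  have := iintD (ccM cm (ccM cp ccpsi)) (ccM cm (ccM cq ccpsi)).
  rewrite IHp // IHq // addr0 => <-; congr iint; apply/funext => x.
  by rewrite mulrDl mulrDr.
- pose al' k := (al k + (k == i))%N.
  have S' : (\sum_(k < n) al' k = (\sum_(k < n) al k).+1)%N.
    rewrite big_split /= -addn1; congr addn.
    by rewrite (bigD1 i) //= eqxx big1 // => k /negbTE ->.
  rewrite -[RHS](IH al'); last by rewrite S' addSnnS.
  congr iint; apply/funext => x; rewrite !mulrA; congr (_ * _ * _).
  rewrite /al' (bigD1 i) //= [RHS](bigD1 i) //= eqxx addn1 exprSr mulrAC.
  by congr (_ * _); apply: eq_bigr => k /negbTE ->; rewrite addn0.
Qed.

(** The moments annihilate the Whitney polynomial [P], which leaves the integral of [(g - P) * psi]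
    over a cube of side [2 * B]. *)
Lemma wavelet_coef_le (L r : nat) (B M tau d : R) (K : nat) psi g :
  cc B psi -> (forall x, `|psi x| <= M) ->
  (forall al : 'I_n -> nat, (\sum_(i < n) al i <= L)%N ->
     iint (fun x => (\prod_(i < n) x ord0 i ^+ al i) * psi x) = 0) ->
  (r <= L.+1)%N -> 0 < tau -> B <= K%:R * tau ->
  continuous g -> mdiff_bound r tau B d g ->
  `|iint (fun x => g x * psi x)| <= (2 * B) ^+ n * (whitney_cst R n K r * d * M).
Proof.
move=> ccpsi psiM mom rL tau0 BK cg Hg; have [B0 cpsi psi0] := ccpsi.
have [P Pr HP] := discrete_whitney tau0 B0 BK (continuous_locally_bounded cg) Hg.
have cP := polylt_continuous Pr.
have cgP : continuous (fun x => g x - P x).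
  by move=> x; apply: (@continuousB _ _ _ g P); [exact: cg|exact: cP].
have -> : iint (fun x => g x * psi x) = iint (fun x => (g x - P x) * psi x).
  have := iintD (ccM cgP ccpsi) (ccM cP ccpsi).
  rewrite (polylt_moment ccpsi mom Pr rL) addr0 => <-.
  by congr iint; apply/funext => x; rewrite -mulrDl subrK.
apply: iint_le; first exact: ccM.
move=> x; have [xB|xB] := leP `|x| B.
  by rewrite normrM; apply: ler_pM => //; exact: HP.
rewrite psi0 // mulr0 normr0; apply: mulr_ge0.
  by apply: le_trans (HP 0 _); rewrite ?normr0.
by apply: le_trans (psiM 0).
Qed.

Lemma eucl_normZ (a : R) x : 0 <= a -> eucl_norm (a *: x) = a * eucl_norm x.
Proof.
move=> a0; rewrite /eucl_norm.
under eq_bigr do rewrite mxE exprMn.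
by rewrite -mulr_sumr sqrtrM ?sqr_ge0 // sqrtr_sqr ger0_norm.
Qed.

Lemma eucl_norm_sqr x : eucl_norm x ^+ 2 = \sum_(i < n) x ord0 i ^+ 2.
Proof. by rewrite sqr_sqrtr // sumr_ge0 // => i _; exact: sqr_ge0. Qed.

Lemma eucl_norm_le (a : R) x : `|x| <= a -> eucl_norm x ^+ 2 <= n%:R * a ^+ 2.
Proof.
move=> xa; rewrite eucl_norm_sqr mulr_natl -[X in _ *+ X](card_ord n) -sumr_const.
apply: ler_sum => i _; rewrite -(real_normK (num_real (x ord0 i))) lerXn2r ?nnegrE //.
  exact: le_trans xa.
exact: le_trans (norm_coord_le _ _) xa.
Qed.

(** A crude linear bound suffices, as only some finite radius is sought. *)
Lemma arccosh_le (t : R) : 1 <= t -> arccosh t <= 2 * t.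
Proof.
move=> t1; rewrite /arccosh.
have s_le : Num.sqrt (t ^+ 2 - 1) <= t.
  rewrite -[leRHS]ger0_norm; last by lra.
  by rewrite -sqrtr_sqr ler_wsqrtr // gerBl.
have s0 := sqrtr_ge0 (t ^+ 2 - 1).
apply: ltW; apply: lt_le_trans (ln_sublinear _) _; lra.
Qed.

(** The coordinate along the axis lies in [5/16, 7/16], and the squares of the others add up to at
    most [n * U ^+ 2], hence to at most 1/256. *)
Lemma eucl_norm_near_axis (i0 : 'I_n) (U : R) (u : V) : 0 <= U ->
  16 * n%:R * U <= 1 ->
  `|u - (3 / 8) *: delta_mx 0 i0| <= U -> 4^-1 < eucl_norm u <= 2^-1.
Proof.
move=> U0 nU uU.
have n1 : (1 : R) <= n%:R by rewrite ler1n; apply: leq_ltn_trans (ltn_ord i0).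
have U16 : 16 * U <= 1 by nra.
have coord i : `|u ord0 i - (if i == i0 then 3 / 8 else 0)| <= U.
  apply: le_trans uU; apply: le_trans (norm_coord_le _ i).
  by rewrite !mxE eqxx /=; case: eqVneq; rewrite ?mulr1 ?mulr0.
have := coord i0; rewrite eqxx ler_norml => /andP[u1 u2].
have sq : eucl_norm u ^+ 2 = u ord0 i0 ^+ 2 + \sum_(i < n | i != i0) u ord0 i ^+ 2.
  by rewrite eucl_norm_sqr (bigD1 i0).
have rest0 : 0 <= \sum_(i < n | i != i0) u ord0 i ^+ 2.
  by apply: sumr_ge0 => i _; exact: sqr_ge0.
have rest : \sum_(i < n | i != i0) u ord0 i ^+ 2 <= n%:R * U ^+ 2.
  apply: (@le_trans _ _ (\sum_(i < n) U ^+ 2)); last first.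
    by rewrite sumr_const card_ord mulr_natl.
  rewrite big_mkcond /=; apply: ler_sum => i _; case: ifPn => [ii0|_]; last exact: sqr_ge0.
  have := coord i; rewrite (negbTE ii0) subr0 => ui.
  by rewrite -(real_normK (num_real (u ord0 i))) lerXn2r ?nnegrE.
have e0 : 0 <= eucl_norm u by exact: sqrtr_ge0.
apply/andP; split; nra.
Qed.

End WaveletCoefficients.

(** * Passage from the cube [I] to the unit scale *)

Section Rescaling.
Variables (R : realType) (n : nat).
Local Notation V := 'rV[R]_n.

(** Kemperman's bound is applied around 3/8 of a unit coordinate vector. The hypothesis on [tau]
    keeps all perturbed directions at Euclidean length in (1/4, 1/2]. *)
Lemma rescaled_mdiff_bound (r : nat) (i0 : 'I_n) (f : V -> R) (sg B d tau : R) (kp : V) :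
  0 <= tau -> 16 * n%:R * (r%:R * tau) <= 1 ->
  (forall x h : V, `|x| <= B + 1 + r%:R -> 4^-1 < eucl_norm h <= 2^-1 ->
     `|cdiff r (sg *: h) f (sg *: (x + kp))| <= d) ->
  mdiff_bound r tau B (2 ^+ r * d) (fun x => f (sg *: (x + kp))).
Proof.
move=> tau0 rtau Hf hs x szh hst xB.
have rtau0 : 0 <= r%:R * tau by rewrite mulr_ge0.
apply: (@mdiff_le_pure R n _ r d tau (B + r%:R * tau) (r%:R * tau)
   ((3 / 8) *: delta_mx 0 i0)) => //; last by rewrite addrK.
move=> {hs x szh hst xB} x u xB uu.
have n1 : (1 : R) <= n%:R by rewrite ler1n; apply: leq_ltn_trans (ltn_ord i0).
have rt16 : 16 * (r%:R * tau) <= 1 by nra.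
have eu := eucl_norm_near_axis rtau0 rtau uu.
have u1 : `|u| <= 1.
  rewrite -[u](subrK ((3 / 8) *: delta_mx 0 i0)).
  apply: le_trans (ler_normD _ _) _.
  have : `|(3 / 8 : R) *: (delta_mx 0 i0 : V)| <= 3 / 8 by apply: norm_step_le; lra.
  lra.
have -> : ndiff r (fun l => f (sg *: (x + l%:R *: u + kp))) =
    cdiff r (sg *: u) f (sg *: (x + (r%:R / 2) *: u + kp)).
  have swap (a : R) : sg *: (x + a *: u + kp) = sg *: (x + kp) + a *: (sg *: u).
    by rewrite addrAC scalerDr !scalerA mulrC.
  rewrite swap cdiff_ndiff; congr ndiff; apply/funext => l.
  by rewrite swap.
(* The margin [1 + r] covers the enlargement of the ball by [r * tau] and the shift by [(r / 2) u]
   from the first node to the centre. *)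
apply: Hf => //; apply: le_trans (ler_normD _ _) _; rewrite normrZ.
rewrite ger0_norm ?divr_ge0 ?ler0n //.
have r0 : (0 : R) <= r%:R by [].
have : r%:R / 2 * `|u| <= r%:R by have := normr_ge0 u; nra.
lra.
Qed.

(** Heights and horizontal distance are all measured in units of [2 ^- j], and the hyperbolic metric
    is invariant under dilation; the bound is therefore uniform in [j] and [k]. *)
Lemma hrho_tent_le (j : nat) (k : 'rV[int]_n) (D y : R) (x : V) p :
  0 <= D -> tent j k p -> `|x| <= D -> 4^-1 < y <= 2^-1 ->
  hrho p (2 ^- j *: (x + intv R k), 2 ^- j * y) <= 2 * (1 + 4 * (n%:R * (D + 1) ^+ 2 + 1)).
Proof.
move=> D0 [pI /andP[p1 p2]] xD /andP[y1 y2].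
set sg : R := 2 ^- j; have sg0 : 0 < sg by rewrite invr_gt0 exprn_gt0.
rewrite -/sg in p1 p2.
have nrm : `|p.1 - sg *: (x + intv R k)| <= sg * (D + 1).
  apply: norm_row_le => [|i]; first by rewrite mulr_ge0 ?ltW // ltr_wpDl.
  have := pI i; rewrite !mxE -/sg => /andP[pi1 pi2].
  have := le_trans (norm_coord_le x i) xD; rewrite !ler_norml => /andP[xi1 xi2].
  apply/andP; split; nra.
have := eucl_norm_le nrm; rewrite exprMn.
set E := eucl_norm _ ^+ 2 => E_le.
have E0 : 0 <= E by exact: sqr_ge0.
set W := n%:R * (D + 1) ^+ 2 in E_le *.
have W0 : 0 <= W by rewrite mulr_ge0 ?sqr_ge0.
have {}E_le : E <= sg ^+ 2 * W by move: E_le; rewrite mulrCA.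
have den0 : 0 < 2 * p.2 * (sg * y).
  by rewrite !mulr_gt0 //; [apply: lt_trans p1; rewrite divr_gt0|lra].
have frac0 : 0 <= (E + (p.2 - sg * y) ^+ 2) / (2 * p.2 * (sg * y)).
  by apply: divr_ge0; [rewrite addr_ge0 // sqr_ge0|exact: ltW].
rewrite /hrho /=; apply: le_trans (arccosh_le _) _; first by rewrite lerDl.
rewrite ler_pM2l // lerD2l ler_pdivrMr //.
(* The heights exceed [sg / 2] and [sg / 4], so twice their product exceeds [sg ^+ 2 / 4]. *)
have den_ge : sg ^+ 2 <= 4 * (2 * p.2 * (sg * y)).
  have py : 2^-1 * 4^-1 <= p.2 / sg * y.
    by apply: ler_pM; rewrite ?ler_pdivlMr ?invr_ge0 ?ltW // mulrC.
  rewrite (_ : 4 * _ = (p.2 / sg * y) * 8 * sg ^+ 2); last by field; rewrite gt_eqF.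
  by rewrite ler_pMl ?exprn_gt0 //; lra.
have diff_le : (p.2 - sg * y) ^+ 2 <= sg ^+ 2.
  rewrite -ler_sqrt ?sqrtr_sqr ?exprn_gt0 // ?sqr_ge0 //.
  rewrite (gtr0_norm sg0) ler_norml; apply/andP; split; nra.
apply: le_trans (_ : sg ^+ 2 * (W + 1) <= _); first by rewrite mulrDr mulr1 lerD.
by rewrite [leRHS]mulrAC; apply: ler_wpM2r; first lra.
Qed.

Lemma continuous_rescale (f : V -> R) (sg : R) (kp : V) : continuous f ->
  continuous (fun x : V => f (sg *: (x + kp))).
Proof.
move=> cf x; apply: (@continuous_comp _ _ _ (fun x : V => sg *: (x + kp)) f);
  last exact: cf.
apply: (@continuous_comp _ _ _ (fun x : V => x + kp) (fun x : V => sg *: x)).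
  by apply: (@continuousD _ _ _ id (fun=> kp)); [exact: cvg_id|exact: cst_continuous].
exact: scaler_continuous.
Qed.

(** The factors on the left are the L2 normalisation, the Jacobian and the size of the differences
    of [f]; the exponents of 2 add up to -jn/2 - js. *)
Lemma scale_powR (s : R) (j : nat) : (0 < n)%N ->
  (2 : R) `^ ((j * n)%:R / 2) * 2 ^- j ^+ n * (2 ^- j) `^ s =
  ((2 : R) ^- (j * n)) `^ (s / n%:R + 2^-1).
Proof.
move=> n0; have nR : n%:R != 0 :> R by rewrite pnatr_eq0 -lt0n.
have E (m : nat) : (2 : R) ^- m = 2 `^ (- m%:R) by rewrite powRN powR_mulrn.
rewrite exprVn -exprM !E -!powRrM -!powRD ?pnatr_eq0 ?implybT //.
by congr powR; rewrite natrM; field.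
Qed.

End Rescaling.

(** * Rescaled coefficients and smallness of differences off the exceptional set *)

Section Coefficient.
Variables (R : realType) (n : nat).
Local Notation V := 'rV[R]_n.

Lemma iint_psiI (psi : 'I_(2 ^ n - 1) -> V -> R) l j (k : 'rV[int]_n) (f : V -> R) (B : R) :
  continuous f -> cc B (psi l) ->
  iint (fun x => f x * psiI psi l j k x) =
  2 `^ ((j * n)%:R / 2) * 2 ^- j ^+ n *
    iint (fun x => f (2 ^- j *: (x + intv R k)) * psi l x).
Proof.
move=> cf ccpsi; have sg0 : 0 < (2 : R) ^+ j by rewrite exprn_gt0.
set c := 2 `^ _.
have cg := @continuous_rescale R n f (2 ^- j) (intv R k) cf.
have ccg := ccM cg ccpsi.
rewrite [X in X * _]mulrC -mulrA exprVn -(iintZ c ccg).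
rewrite -(iint_affine (- intv R k) sg0 (ccZ c ccg)).
congr iint; apply/funext => x; rewrite /psiI -/c subrK scalerA mulVf ?gt_eqF // scale1r.
by rewrite mulrCA.
Qed.

(** The assumed range of the length of [h] is exactly the range of heights at level [j + 1], so a
    single level governs all these differences. *)
Lemma cdiff_le_of_notin_Sset (r j : nat) (s eps : R) (f : V -> R) (z h : V) :
  0 < s -> 0 <= eps ->
  2 ^- j * 4^-1 < eucl_norm h <= 2 ^- j * 2^-1 ->
  ~ Sset r j.+1 s f eps (z, eucl_norm h) ->
  `|cdiff r h f z| <= eps * (2 ^- j) `^ s.
Proof.
move=> s0 eps0 /andP[h1 h2] nS; set y := eucl_norm h in h1 h2 nS.
have sg0 : 0 < (2 : R) ^- j by rewrite invr_gt0 exprn_gt0.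
have y0 : 0 < y by apply: lt_trans h1; rewrite mulr_gt0.
have ys0 : 0 < y `^ s by exact: powR_gt0.
have le1 : (DeltaR r f z y * ((y `^ s)^-1)%:E <= eps%:E)%E.
  rewrite leNgt; apply/negP => gt; apply: nS; split=> //=.
  rewrite !exprS !invfM -/y; apply/andP; split; first by apply: le_lt_trans h1; lra.
  by apply: le_trans h2 _; lra.
have le2 : `|cdiff r h f z| / (y `^ s) <= eps.
  rewrite -lee_fin EFinM; apply: le_trans le1; apply: lee_wpmul2r.
    by rewrite lee_fin invr_ge0 ltW.
  by apply: ereal_sup_ubound; exists h.
rewrite ler_pdivrMr // in le2; apply: le_trans le2 _; apply: ler_wpM2l => //.
apply: ge0_ler_powR; rewrite ?nnegrE ?ltW //.
by apply: le_lt_trans h2 _; lra.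
Qed.

End Coefficient.

(** * Choice of the constants and proof of the inclusion by contradiction *)

Theorem mainTheorem9 (R : realType) (n L : nat) (phi : 'rV[R]_n -> R)
  (psi : 'I_(2 ^ n - 1) -> 'rV[R]_n -> R) (s : R) (r : nat) :
  (0 < n)%N -> daubechies_system L phi psi ->
  0 < s -> s < r%:R -> (r.-1 <= L)%N ->
  exists (c : R) (m : nat) (Rad : R),
    [/\ 0 < c < 1, (0 < m)%N, 1 < Rad &
      forall f : 'rV[R]_n -> R, Lambda s f ->
      forall (eps : R) (j : nat), 0 < eps ->
        Tset psi s f eps j `<=`
        \bigcup_(i in [set i : nat | (j < i <= j + m)%N])
           henlarge (Sset r i s f (c * eps)) Rad].
Proof.
move=> n0 [_ psiC moments _ _] s0 sr rL.
have r0 : (0 < r)%N by rewrite -(ltr_nat R); exact: lt_trans sr.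
have /choice [Bf HB] l : exists B : R, cc B (psi l).
  have [psiCL supp] := psiC l; apply: compact_support_cc => //.
  by case: (L) psiCL => [|?] [].
(* A sum of nonnegative radii dominates each of them and so serves all the wavelets at once; [M] is
   formed likewise. *)
pose B := \sum_l Bf l.
have Bf0 l : 0 <= Bf l by case: (HB l).
have ccpsi l : cc B (psi l).
  apply: cc_widen (HB l); rewrite /B (bigD1 l) //= lerDl; exact: sumr_ge0.
have B0 : 0 <= B by exact: sumr_ge0.
have /choice [Mf HM] l : exists M : R, 0 <= M /\ forall x, `|psi l x| <= M.
  by have [M ? ?] := cc_bounded (HB l); exists M.
pose M := \sum_l Mf l.
have M0 : 0 <= M by apply: sumr_ge0 => l _; case: (HM l).
have psiM l x : `|psi l x| <= M.
  have [_ /(_ x) /le_trans] := HM l; apply.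
  by rewrite /M (bigD1 l) //= lerDl; apply: sumr_ge0 => i _; case: (HM i).
have nR : (0 : R) < n%:R by rewrite ltr0n.
have rR : (0 : R) < r%:R by rewrite ltr0n.
(* This is the largest [tau] that [rescaled_mdiff_bound] allows. *)
pose tau : R := (16 * n%:R * r%:R)^-1.
have tau0 : 0 < tau by rewrite invr_gt0 !mulr_gt0.
have tau1 : 16 * n%:R * (r%:R * tau) <= 1.
  by rewrite mulrA mulfV // gt_eqF // !mulr_gt0.
pose K := Num.bound (B / tau).
have BK : B <= K%:R * tau.
  rewrite -ler_pdivrMr //; apply/ltW; apply: le_lt_trans (archi_boundP _); first exact: lexx.
  by rewrite divr_ge0 // ltW.
pose Q := (2 * B) ^+ n * (whitney_cst R n K r * 2 ^+ r * M).
have Q0 : 0 <= Q.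
  by rewrite !mulr_ge0 ?exprn_ge0 ?mulr_ge0 // whitney_cst_ge0.
(* [D] is the radius in [rescaled_mdiff_bound] and [2 * T] the distance in [hrho_tent_le]; the 1
   added below makes that bound strict. *)
pose D : R := B + 1 + r%:R.
have D0 : 0 <= D by rewrite !addr_ge0.
pose T : R := 1 + 4 * (n%:R * (D + 1) ^+ 2 + 1).
have T1 : 1 <= T by rewrite lerDl mulr_ge0 // addr_ge0 // mulr_ge0 // sqr_ge0.
(* A coefficient costs the factor [Q], so [c] must satisfy [Q * c <= 1]; adding 2 also gives [c < 1]
   when [Q = 0]. *)
exists (Q + 2)^-1, 1%N, (2 * T + 1); split=> //.
- have Q2 : 0 < Q + 2 by lra.
  by rewrite invr_gt0 Q2 invf_lt1 //=; lra.
- lra.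
move=> f [cf _ _] eps j eps0 p [k /= kW pk]; exists j.+1; first by rewrite /= addn1 !leqnn.
apply: contrapT => npS.
pose sg : R := 2 ^- j; have sg0 : 0 < sg by rewrite invr_gt0 exprn_gt0.
have ceps0 : 0 < (Q + 2)^-1 * eps by rewrite mulr_gt0 // invr_gt0; lra.
have p20 : 0 < p.2.
  by case: pk => _ /andP[+ _]; apply: lt_trans; rewrite divr_gt0.
pose d := (Q + 2)^-1 * eps * sg `^ s.
have pure (x h : 'rV[R]_n) : `|x| <= D -> 4^-1 < eucl_norm h <= 2^-1 ->
    `|cdiff r (sg *: h) f (sg *: (x + intv R k))| <= d.
  move=> xD hh; have /andP[h1 h2] := hh.
  apply: cdiff_le_of_notin_Sset => //; first exact: ltW.
    by rewrite eucl_normZ ?(ltW sg0) // ltr_pM2l // ler_pM2l // h1.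
  (* A point of the exceptional set this close to [p] would put [p] into the enlargement. *)
  move=> inS; apply: npS; split=> //.
  apply: le_lt_trans (_ : ((2 * T)%:E < _)%E); last by rewrite lte_fin ltrDl.
  apply: le_trans (_ : ((hrho p (sg *: (x + intv R k), eucl_norm (sg *: h)))%:E <= _)%E).
    by apply: ereal_inf_lbound; exists (sg *: (x + intv R k), eucl_norm (sg *: h)).
  by rewrite lee_fin eucl_normZ ?(ltW sg0) //; exact: hrho_tent_le.
have i0 := Ordinal n0.
have Hg := rescaled_mdiff_bound i0 (ltW tau0) tau1 pure.
have cg := @continuous_rescale R n f sg (intv R k) cf.
move: kW; rewrite /inW /= => /lt_geF/negP; apply.
apply/bigmax_leP; split=> [|l _]; first by rewrite mulr_ge0 ?powR_ge0 // ltW.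
rewrite (iint_psiI j k cf (ccpsi l)) -(scale_powR s j n0) normrM ger0_norm; last first.
  by rewrite mulr_ge0 ?powR_ge0 // exprn_ge0 // ltW.
rewrite mulrCA -/sg; apply: ler_wpM2l; first by rewrite mulr_ge0 ?powR_ge0 // exprn_ge0 // ltW.
have rL1 : (r <= L.+1)%N by rewrite -(prednK r0).
apply: le_trans (wavelet_coef_le (ccpsi l) (psiM l) (moments l) rL1 tau0 BK cg Hg) _.
rewrite (_ : (2 * B) ^+ n * _ = (Q / (Q + 2)) * (eps * sg `^ s)); last by rewrite /Q /d; ring.
apply: ler_piMl; first by rewrite mulr_ge0 ?powR_ge0 // ltW.
by rewrite ler_pdivrMr ?mul1r; lra.
Qed.
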